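(* Let $\mathrm{ZX}_{\mathsf{simp}}$ be the simplified stabilizer ZX-calculus described in the context. The rule (S3$'$L), i.e. the equation $\eta=R_Z^{(0,2)}(0)$ between the cap and the green spider with no input, two outputs and angle $0$, is necessary: $\mathrm{ZX}_{\mathsf{simp}}\setminus(\mathrm{S3'L})\not\vdash(\mathrm{S3'L})$. That is, this equation is not derivable from the remaining rules.
   Context: **Diagrams.** Diagrams $D:n\to m$ ($n,m\in\mathbb N$) are the morphisms of the free strict monoidal category with objects $\mathbb N$ (tensor on objects is addition) generated by: green spiders $R_Z^{(n,m)}(\alpha):n\to m$ and red spiders $R_X^{(n,m)}(\alpha):n\to m$ for all $n,m\in\mathbb N$ and $\alpha\in\{k\pi/2\mid k\in\mathbb Z\}$ (angles are real numbers, not taken modulo $2\pi$); $H:1\to1$; the swap $\sigma:2\to2$; the cup $\epsilon:2\to0$; the cap $\eta:0\to2$. The identity on $n$ is $1_n$, and $e=1_0$ is the empty diagram. $D_2\circ D_1$ means first $D_1$ then $D_2$; in $D_1\otimes D_2$, $D_1$ is on the left. Put $R_Z^{(n,m)}:=R_Z^{(n,m)}(0)$, $R_X^{(n,m)}:=R_X^{(n,m)}(0)$. **Only connectivity matters (meta rule).** $G_D=(V,E,\ell)$ has one vertex for each spider, each $H$, each input and each output of $D$, and one edge for each wire of $D$ (wires being followed through swaps, cups and caps), joining the vertices at its two ends. A green (red) spider of angle $\alpha$ is labelled $R_Z(\alpha)$ ($R_X(\alpha)$), an $H$ is labelled $H$, the $j$-th input (output) from the left is labelled $I_j$ ($O_j$).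 The order and direction in which wires are attached to a spider or $H$ is not recorded. The meta rule: $D_1=D_2$ whenever there is a bijection of the vertices of $G_{D_1}$ and $G_{D_2}$ preserving labels and the number of edges between any two (possibly equal) vertices, and the two diagrams have the same number of closed wire loops carrying no vertex. **Calculus.** For a set $R$ of rules, $R\vdash D_1=D_2$ means that $(D_1,D_2)$ belongs to the smallest equivalence relation on parallel diagrams that is closed under $\circ$ and $\otimes$ and contains all equations in $R$. $\mathrm{ZX}_{\mathsf{simp}}$ consists of the meta rule above and of the following rules; $\mathrm{ZX}_{\mathsf{simp}}\setminus(\mathrm X)$ is obtained by deleting all instances of rule (X). - (S1) for all $a,b,c,d\ge0$, $k\ge1$ and all $\alpha,\beta$: $(1_b\otimes R_Z^{(k+c,d)}(\beta))\circ(R_Z^{(a,b+k)}(\alpha)\otimes1_c)=R_Z^{(a+c,b+d)}(\alpha+\beta)$ (ordinary addition of angles). - (S3$'$L) $\eta=R_Z^{(0,2)}$; (S3$'$R) $R_Z^{(0,2)}=R_X^{(0,2)}$. - (B1) $(R_Z^{(1,0)}\circ R_X^{(0,1)})\otimes(R_Z^{(1,2)}\circ R_X^{(0,1)})=R_X^{(0,1)}\otimes R_X^{(0,1)}$. - (B2$'$) $R_Z^{(0,0)}\otimes\big[(R_X^{(2,1)}\otimes R_X^{(2,1)})\circ(1_1\otimes\sigma\otimes1_1)\circ(R_Z^{(1,2)}\otimes R_Z^{(1,2)})\big]=(R_Z^{(1,0)}\circ R_X^{(0,1)})\otimes(R_Z^{(1,2)}\circ R_X^{(2,1)})$. - (EU$'$)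 $H=R_Z^{(1,1)}(\tfrac\pi2)\circ R_X^{(2,1)}\circ(R_Z^{(0,1)}(-\tfrac\pi2)\otimes1_1)\circ R_Z^{(1,1)}(\tfrac\pi2)$. - (H) for all $n,m,\alpha$: $H^{\otimes m}\circ R_X^{(n,m)}(\alpha)\circ H^{\otimes n}=R_Z^{(n,m)}(\alpha)$. - (IV$'$) $R_Z^{(0,0)}\otimes(R_X^{(3,0)}\circ R_Z^{(0,3)})\otimes(R_X^{(3,0)}\circ R_Z^{(0,3)})=e$. - (ZO$'$) $R_Z^{(0,0)}(\pi)\otimes R_Z^{(0,1)}=R_Z^{(0,0)}(\pi)\otimes R_X^{(0,1)}$. *)

(* Defs.v *)
From HB Require Import structures.
From mathcomp Require Import all_boot all_order all_algebra.
Set Implicit Arguments.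
Unset Strict Implicit.
Unset Printing Implicit Defensive.

Declare Scope diag_scope.
Delimit Scope diag_scope with D.

(* All angles are integer multiples of pi/2: k : angle stands for the real
   number k * pi/2.  Angles are not reduced modulo 2 * pi. *)
Definition angle := int.
Definition half_pi : angle := 1%R.
Definition pi_angle : angle := 2%R.

(* Terms for morphisms of the free strict monoidal category on the generators;
   the equations of strict monoidal categories are [strict_monoidal] below and
   hold in every derivability relation. *)
Inductive diag : nat -> nat -> Type :=
| Id n : diag n n
| RZ n m (a : angle) : diag n m
| RX n m (a : angle) : diag n m
| Had : diag 1 1
| Swap : diag 2 2
| Cup : diag 2 0
| Cap : diag 0 2
| Comp n m p (D2 : diag m p) (D1 : diag n m) : diag n p
| Tens n m n' m' (D1 : diag n m) (D2 : diag n' m') : diag (n + n') (m + m').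

Bind Scope diag_scope with diag.

Reserved Notation "D1 \ox D2" (at level 40, left associativity).
Notation "D2 \o D1" := (Comp D2 D1) : diag_scope.
Notation "D1 \ox D2" := (Tens D1 D2) : diag_scope.

Local Open Scope diag_scope.

Definition castd n n' m m' (en : n = n') (em : m = m') (D : diag n m) :
    diag n' m' :=
  let: erefl in _ = n'' := en return diag n'' m' in
  let: erefl in _ = m'' := em return diag n m'' in D.

Fixpoint Hpow n : diag n n :=
  if n is n'.+1 then Tens Had (Hpow n') else Id 0.

Definition rel_diag := forall n m : nat, diag n m -> diag n m -> Prop.

Inductive strict_monoidal : rel_diag :=
| SM_compA n m p q (D3 : diag p q) (D2 : diag m p) (D1 : diag n m) :
    strict_monoidal (D3 \o (D2 \o D1)) ((D3 \o D2) \o D1)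
| SM_id_comp n m (D : diag n m) : strict_monoidal (Id m \o D) D
| SM_comp_id n m (D : diag n m) : strict_monoidal (D \o Id n) D
| SM_interchange n m p n' m' p'
    (D2 : diag m p) (D1 : diag n m) (D2' : diag m' p') (D1' : diag n' m') :
    strict_monoidal ((D2 \o D1) \ox (D2' \o D1')) ((D2 \ox D2') \o (D1 \ox D1'))
| SM_tens_id n m : strict_monoidal (Id n \ox Id m) (Id (n + m))
| SM_tensA n1 m1 n2 m2 n3 m3
    (D1 : diag n1 m1) (D2 : diag n2 m2) (D3 : diag n3 m3) :
    strict_monoidal
      (castd (addnA n1 n2 n3) (addnA m1 m2 m3) (D1 \ox (D2 \ox D3)))
      ((D1 \ox D2) \ox D3)
| SM_id0_tens n m (D : diag n m) : strict_monoidal (Id 0 \ox D : diag n m) D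
| SM_tens_id0 n m (D : diag n m) :
    strict_monoidal (castd (addn0 n) (addn0 m) (D \ox Id 0)) D.

Inductive label :=
| LZ of angle
| LX of angle
| LH
| LI of nat
| LO of nat.

(* A wiring of a diagram n -> m.  Nodes are the occurrences of spiders and H.
   Pieces are elementary strands: the legs of spiders and H, and the strands of
   identities, swaps, cups and caps.  A leg has one end fixed at its node
   (its foot); [link] holds between pieces glued end to end by a composition, so
   that a full wire is a connected component of [link]. *)
Record wiring (n m : nat) := Wiring {
  node : finType;
  node_label : node -> label;
  leg : finType;
  foot : leg -> node;
  piece : finType;
  leg_piece : leg -> piece;
  in_piece : 'I_n -> piece;
  out_piece : 'I_m -> piece;
  link : rel piece
}.

Definition box_wiring n m (l : label) : wiring n m :=
  @Wiring n m unit (fun=> l) ('I_n + 'I_m)%type (fun=> tt)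
    ('I_n + 'I_m)%type id inl inr (fun _ _ => false).

Definition strand_wiring n m (P : finType) (i : 'I_n -> P) (o : 'I_m -> P) :
    wiring n m :=
  @Wiring n m void (fun v => match v with end) void id
    P (fun v => match v with end) i o (fun _ _ => false).

Definition sum_map (A B A' B' : Type) (f : A -> A') (g : B -> B')
    (x : A + B) : A' + B' :=
  match x with inl a => inl (f a) | inr b => inr (g b) end.

Definition sum_case (A B C : Type) (f : A -> C) (g : B -> C) (x : A + B) : C :=
  match x with inl a => f a | inr b => g b end.

Definition comp_wiring n m p (G2 : wiring m p) (G1 : wiring n m) : wiring n p :=
  @Wiring n p
    (node G1 + node G2)%type (sum_case (@node_label _ _ G1) (@node_label _ _ G2))
    (leg G1 + leg G2)%type (sum_map (@foot _ _ G1) (@foot _ _ G2))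
    (piece G1 + piece G2)%type
    (sum_map (@leg_piece _ _ G1) (@leg_piece _ _ G2))
    (fun i => inl (in_piece G1 i)) (fun j => inr (out_piece G2 j))
    (fun x y => match x, y with
     | inl x1, inl y1 => link x1 y1
     | inr x2, inr y2 => link x2 y2
     | inl z1, inr z2 | inr z2, inl z1 =>
         [exists j : 'I_m, (out_piece G1 j == z1) && (in_piece G2 j == z2)]
     end).

Definition tens_wiring n m n' m' (G1 : wiring n m) (G2 : wiring n' m') :
    wiring (n + n') (m + m') :=
  @Wiring (n + n') (m + m')
    (node G1 + node G2)%type (sum_case (@node_label _ _ G1) (@node_label _ _ G2))
    (leg G1 + leg G2)%type (sum_map (@foot _ _ G1) (@foot _ _ G2))
    (piece G1 + piece G2)%type
    (sum_map (@leg_piece _ _ G1) (@leg_piece _ _ G2))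
    (fun i => sum_map (in_piece G1) (in_piece G2) (split i))
    (fun j => sum_map (out_piece G1) (out_piece G2) (split j))
    (fun x y => match x, y with
     | inl x1, inl y1 => link x1 y1
     | inr x2, inr y2 => link x2 y2
     | _, _ => false
     end).

Fixpoint wiring_of n m (D : diag n m) : wiring n m :=
  match D in diag n m return wiring n m with
  | Id n => strand_wiring id id
  | RZ n m a => box_wiring n m (LZ a)
  | RX n m a => box_wiring n m (LX a)
  | Had => box_wiring 1 1 LH
  | Swap => strand_wiring id (@rev_ord 2)
  | Cup => @strand_wiring 2 0 unit (fun=> tt) (fun=> tt)
  | Cap => @strand_wiring 0 2 unit (fun=> tt) (fun=> tt)
  | Comp _ _ _ D2 D1 => comp_wiring (wiring_of D2) (wiring_of D1)
  | Tens _ _ _ _ D1 D2 => tens_wiring (wiring_of D1) (wiring_of D2)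
  end.

Section Graph.
Variables (n m : nat) (G : wiring n m).

Definition vertex : finType := (node G + ('I_n + 'I_m))%type.

Definition vertex_label (v : vertex) : label :=
  match v with
  | inl x => node_label x
  | inr (inl i) => LI i
  | inr (inr j) => LO j
  end.

(* The places where a wire can end: at a leg's foot, an input or an output. *)
Definition wire_end : finType := (leg G + ('I_n + 'I_m))%type.

Definition end_vertex (e : wire_end) : vertex :=
  match e with
  | inl l => inl (foot l)
  | inr b => inr b
  end.

Definition end_piece (e : wire_end) : piece G :=
  match e with
  | inl l => leg_piece l
  | inr (inl i) => in_piece G i
  | inr (inr j) => out_piece G j
  end.

Definition wires : {set {set piece G}} :=
  equivalence_partition (connect (@link n m G)) [set: piece G].

(* A wire which is not a closed loop has exactly two ends.  These are distinct
   even when they lie at the same vertex or on the same piece. *)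
Definition joins (w : {set piece G}) (u v : vertex) : bool :=
  [exists e, exists e', [&& e != e', end_piece e \in w, end_piece e' \in w,
                            end_vertex e == u & end_vertex e' == v]].

Definition nb_edges (u v : vertex) : nat := #|[set w in wires | joins w u v]|.

Definition nb_loops : nat :=
  #|[set w in wires | [forall e, end_piece e \notin w]]|.

End Graph.

Definition same_connectivity n m (D1 D2 : diag n m) : Prop :=
  let G1 := wiring_of D1 in let G2 := wiring_of D2 in
  (exists f : vertex G1 -> vertex G2,
     [/\ bijective f,
         forall v, vertex_label (f v) = vertex_label v
       & forall u v, nb_edges (f u) (f v) = nb_edges u v])
  /\ nb_loops G1 = nb_loops G2.

Variant rule_name :=
  Meta | S1 | S3'L | S3'R | B1 | B2' | EU' | Hrule | IV' | ZO'.

Inductive rule : rule_name -> rel_diag :=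
| rule_Meta n m (D1 D2 : diag n m) :
    same_connectivity D1 D2 -> rule Meta D1 D2
| rule_S1 a b c d k (alpha beta : angle) :
    0 < k ->
    rule S1
      (castd (addnA b k c) erefl (Id b \ox RZ (k + c) d beta)
         \o (RZ a (b + k) alpha \ox Id c))
      (RZ (a + c) (b + d) (alpha + beta)%R)
| rule_S3'L : rule S3'L Cap (RZ 0 2 0%R)
| rule_S3'R : rule S3'R (RZ 0 2 0%R) (RX 0 2 0%R)
| rule_B1 :
    rule B1
      ((RZ 1 0 0%R \o RX 0 1 0%R) \ox (RZ 1 2 0%R \o RX 0 1 0%R) : diag 0 2)
      (RX 0 1 0%R \ox RX 0 1 0%R : diag 0 2)
| rule_B2' :
    rule B2'
      (RZ 0 0 0%R \ox
         ((RX 2 1 0%R \ox RX 2 1 0%R) \o (Id 1 \ox Swap \ox Id 1)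
            \o (RZ 1 2 0%R \ox RZ 1 2 0%R)) : diag 2 2)
      ((RZ 1 0 0%R \o RX 0 1 0%R) \ox (RZ 1 2 0%R \o RX 2 1 0%R) : diag 2 2)
| rule_EU' :
    rule EU'
      Had
      (RZ 1 1 half_pi \o RX 2 1 0%R \o (RZ 0 1 (- half_pi)%R \ox Id 1)
         \o RZ 1 1 half_pi)
| rule_H n m (alpha : angle) :
    rule Hrule (Hpow m \o RX n m alpha \o Hpow n) (RZ n m alpha)
| rule_IV' :
    rule IV'
      (RZ 0 0 0%R \ox (RX 3 0 0%R \o RZ 0 3 0%R)
         \ox (RX 3 0 0%R \o RZ 0 3 0%R) : diag 0 0)
      (Id 0)
| rule_ZO' :
    rule ZO'
      (RZ 0 0 pi_angle \ox RZ 0 1 0%R : diag 0 1)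
      (RZ 0 0 pi_angle \ox RX 0 1 0%R : diag 0 1).

Definition ZXsimp : rel_diag :=
  fun n m D1 D2 => exists r, @rule r n m D1 D2.

Definition ZXsimp_without (x : rule_name) : rel_diag :=
  fun n m D1 D2 => exists2 r, r <> x & @rule r n m D1 D2.

Inductive derivable (R : rel_diag) : rel_diag :=
| der_rule n m (D1 D2 : diag n m) : R n m D1 D2 -> derivable R D1 D2
| der_monoidal n m (D1 D2 : diag n m) :
    strict_monoidal D1 D2 -> derivable R D1 D2
| der_refl n m (D : diag n m) : derivable R D D
| der_sym n m (D1 D2 : diag n m) : derivable R D1 D2 -> derivable R D2 D1
| der_trans n m (D1 D2 D3 : diag n m) :
    derivable R D1 D2 -> derivable R D2 D3 -> derivable R D1 D3
| der_comp n m p (D2 D2' : diag m p) (D1 D1' : diag n m) :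
    derivable R D2 D2' -> derivable R D1 D1' ->
    derivable R (D2 \o D1) (D2' \o D1')
| der_tens n m n' m' (D1 D1' : diag n m) (D2 D2' : diag n' m') :
    derivable R D1 D1' -> derivable R D2 D2' ->
    derivable R (D1 \ox D2) (D1' \ox D2').

(* Main.v *)
(** A wire may carry either of two values, and every wire that meets a spider or
    an H must carry the value [true]; wires are otherwise unconstrained.  Recording
    which boundary values extend to the whole diagram gives a model of the
    calculus in relations over [bool].  It depends on the graph only, which gives
    the meta rule, and both sides of every remaining rule other than (S3'L) force
    all boundary values to be [true].  The cap, however, also admits the boundary
    value (false, false), which the green spider rejects. *)
Require Import Defs.
From mathcomp Require Import all_boot all_order all_algebra.
From mathcomp Require Import zify.
Set Implicit Arguments.
Unset Strict Implicit.
Unset Printing Implicit Defensive.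

(** * Relational semantics of diagrams over [bool] *)

(* Boundary values are functions on nat of which only the values below the arity
   matter; this makes [interp] insensitive to [castd]. *)
Fixpoint interp n m (D : diag n m) (x y : nat -> bool) : Prop :=
  match D with
  | Id n => forall i, i < n -> x i = y i
  | RZ n m _ | RX n m _ => (forall i, i < n -> x i) /\ (forall j, j < m -> y j)
  | Had => x 0 /\ y 0
  | Swap => x 0 = y 1 /\ x 1 = y 0
  | Cup => x 0 = x 1
  | Cap => y 0 = y 1
  | Comp _ _ _ D2 D1 => exists2 z, interp D1 x z & interp D2 z y
  | Tens n m _ _ D1 D2 =>
      interp D1 x y /\ interp D2 (fun i => x (n + i)) (fun j => y (m + j))
  end.

Lemma interp_castd n n' m m' (en : n = n') (em : m = m') (D : diag n m) :
  interp (castd en em D) = interp D.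
Proof. by case: n' / en; case: m' / em. Qed.

(** Stands in for functional extensionality: shifted or glued boundary functions agree only
    pointwise, and often only below the arity. *)
Lemma interp_ext n m (D : diag n m) x x' y y' :
  (forall i, i < n -> x i = x' i) -> (forall j, j < m -> y j = y' j) ->
  interp D x y -> interp D x' y'.
Proof.
elim: D x x' y y' => /=.
- by move=> k x x' y y' ex ey h i lti; rewrite -ex // -ey // h.
- by move=> k l _ x x' y y' ex ey [hx hy]; split=> i lti;
    rewrite -?ex -?ey //; auto.
- by move=> k l _ x x' y y' ex ey [hx hy]; split=> i lti;
    rewrite -?ex -?ey //; auto.
- by move=> x x' y y' ex ey; rewrite ex // ey.
- by move=> x x' y y' ex ey; rewrite !ex // !ey.
- by move=> x x' y y' ex ey; rewrite !ex.
- by move=> x x' y y' ex ey; rewrite !ey.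
- move=> k l p D2 IH2 D1 IH1 x x' y y' ex ey [z h1 h2].
  by exists z; [apply: IH1 h1 | apply: IH2 h2].
- move=> k l k' l' D1 IH1 D2 IH2 x x' y y' ex ey [h1 h2]; split.
    by apply: IH1 h1 => i lti; [apply: ex | apply: ey]; lia.
  by apply: IH2 h2 => i lti; [apply: ex | apply: ey]; lia.
Qed.

(** Colouring every wire [true] meets all constraints; this gives the converse half of
    [interp_forces]. *)
Lemma interp_true n m (D : diag n m) :
  interp D (fun=> true) (fun=> true).
Proof. by elim: D => //= *; exists (fun=> true). Qed.

(** * Invariance under the strict monoidal equations *)

Definition glue n (x y : nat -> bool) i := if i < n then x i else y (i - n).

Lemma glue_lt n x y i : i < n -> glue n x y i = x i.
Proof. by rewrite /glue => ->. Qed.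

Lemma glue_add n x y i : glue n x y (n + i) = y i.
Proof. by rewrite /glue ltnNge leq_addr addKn. Qed.

Lemma interp_strict_monoidal n m (D1 D2 : diag n m) :
  strict_monoidal D1 D2 -> forall x y, interp D1 x y <-> interp D2 x y.
Proof.
case=> {n m D1 D2}.
- move=> n m p q D3 D2 D1 x y /=; split.
    by case=> z [w h1 h2] h3; exists w => //; exists z.
  by case=> z h1 [w h2 h3]; exists w => //; exists z.
- move=> n m D x y /=; split=> [[z hz eyz]|h]; last by exists y.
  by apply: interp_ext hz.
- move=> n m D x y /=; split=> [[z exz hz]|h]; last by exists x.
  by apply: interp_ext hz => // i /exz ->.
- move=> n m p n' m' p' D2 D1 D2' D1' x y /=; split.
    case=> -[z h1 h2] [z' h1' h2']; exists (glue m z z'); split.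
    + by apply: interp_ext h1 => // i lti; rewrite glue_lt.
    + by apply: interp_ext h1' => // i lti; rewrite glue_add.
    + by apply: interp_ext h2 => // i lti; rewrite glue_lt.
    + by apply: interp_ext h2' => // i lti; rewrite glue_add.
  case=> z [h1 h1'] [h2 h2']; split; first by exists z.
  by exists (fun i => z (m + i)).
- move=> n m x y /=; split=> [[h1 h2] i lti|h].
    have [/h1 //|le_ni] := ltnP i n.
    by have := h2 (i - n); rewrite subnKC //; apply; lia.
  by split=> i lti; apply: h; lia.
- move=> n1 m1 n2 m2 n3 m3 D1 D2 D3 x y; rewrite interp_castd /=.
  suff h3 : interp D3 (fun i => x (n1 + (n2 + i))) (fun j => y (m1 + (m2 + j)))
    <-> interp D3 (fun i => x (n1 + n2 + i)) (fun j => y (m1 + m2 + j)) by tauto.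
  by split; apply: interp_ext => i _; rewrite addnA.
- by move=> n m D x y /=; split=> [[]|].
- by move=> n m D x y; rewrite interp_castd /=; split=> [[]|].
Qed.

(** * Diagrams that force all their boundary values to [true] *)

Definition forces_in n m (D : diag n m) :=
  forall x y, interp D x y -> forall i, i < n -> x i.

Definition forces_out n m (D : diag n m) :=
  forall x y, interp D x y -> forall j, j < m -> y j.

Definition forces n m (D : diag n m) := forces_in D /\ forces_out D.

(** The relation of a forcing diagram is determined by its arities alone, so any two parallel
    forcing diagrams agree. *)
Lemma interp_forces n m (D : diag n m) x y : forces D ->
  interp D x y <-> (forall i, i < n -> x i) /\ (forall j, j < m -> y j).
Proof.
case=> fin fout; split=> [h|[hx hy]]; first by split; [apply: fin h | apply: fout h].
by apply: interp_ext (interp_true D) => i lti; rewrite ?hx ?hy.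
Qed.

(** Inputs and outputs are treated apart: one outer factor suffices for each side, so inner layers
    may contain strands that force nothing. *)
Lemma forces_in_comp n m p (D2 : diag m p) (D1 : diag n m) :
  forces_in D1 -> forces_in (D2 \o D1)%D.
Proof. by move=> fin x y /= [z h1 h2]; apply: fin h1. Qed.

Lemma forces_out_comp n m p (D2 : diag m p) (D1 : diag n m) :
  forces_out D2 -> forces_out (D2 \o D1)%D.
Proof. by move=> fout x y /= [z h1 h2]; apply: fout h2. Qed.

Lemma forces_comp n m p (D2 : diag m p) (D1 : diag n m) :
  forces D2 -> forces D1 -> forces (D2 \o D1)%D.
Proof.
by move=> f2 f1; split; [apply/forces_in_comp/f1.1 | apply/forces_out_comp/f2.2].
Qed.

Lemma forces_tens n m n' m' (D1 : diag n m) (D2 : diag n' m') :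
  forces D1 -> forces D2 -> forces (D1 \ox D2)%D.
Proof.
move=> [i1 o1] [i2 o2]; split=> x y /= [h1 h2] i lti.
  have [lt_in|le_ni] := ltnP i n; first exact: i1 h1 _ lt_in.
  by have := i2 _ _ h2 (i - n); rewrite subnKC //; apply; lia.
have [lt_im|le_mi] := ltnP i m; first exact: o1 h1 _ lt_im.
by have := o2 _ _ h2 (i - m); rewrite subnKC //; apply; lia.
Qed.

Lemma forces_RZ n m a : forces (RZ n m a).
Proof. by split=> x y []. Qed.

Lemma forces_RX n m a : forces (RX n m a).
Proof. by split=> x y []. Qed.

Lemma forces_Had : forces Had.
Proof. by split=> x y [hx hy] [|]. Qed.

Lemma forces_Hpow n : forces (Hpow n).
Proof.
by elim: n => [|n IHn] //=; apply: (forces_tens forces_Had IHn).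
Qed.

(** Strands run past each spider, so the layers are not forcing in general. The last [c] inputs are
    forced by the second spider and the first [b] outputs by the first one. *)
Lemma forces_S1_lhs a b c d k alpha beta :
  forces (castd (addnA b k c) erefl (Id b \ox RZ (k + c) d beta)
            \o (RZ a (b + k) alpha \ox Id c))%D.
Proof.
split=> x y /= [z [[hx hz] hc]]; rewrite interp_castd /= => -[hb [hk hd]] i lti.
  have [/hx //|le_ai] := ltnP i a.
  have := hc (i - a); rewrite subnKC // => ->; last by lia.
  by rewrite -addnA; apply: hk; lia.
have [lt_ib|le_bi] := ltnP i b; first by rewrite -hb // hz //; lia.
by have := hd (i - b); rewrite subnKC //; apply; lia.
Qed.

(** * Colourings of wirings and invariance under the meta rule *)

(** Colours sit on pieces rather than on whole wires: composition merges wires, but on pieces it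
    only adds links. *)
Definition wiring_interp n m (G : wiring n m) (x y : nat -> bool) : Prop :=
  exists c : piece G -> bool,
    [/\ forall p q, link p q -> c p = c q,
        forall l, c (leg_piece l),
        forall i : 'I_n, c (in_piece G i) = x i
      & forall j : 'I_m, c (out_piece G j) = y j].

(** The default [true] encodes the constraint that a spider or [H] puts on its wires. *)
Definition label_value (x y : nat -> bool) (l : label) : bool :=
  match l with LI i => x i | LO j => y j | _ => true end.

(* Pieces of a wire all carry the same value, so a colouring exists as soon as
   the two ends of each wire agree; this is what makes [interp] a graph
   invariant. *)
Lemma wiring_interpP n m (G : wiring n m) x y :
  symmetric (@link _ _ G) -> (forall v : node G, label_value x y (node_label v)) ->
  wiring_interp G x y <->
  (forall u v : vertex G, 0 < nb_edges u v ->
     label_value x y (vertex_label u) = label_value x y (vertex_label v)).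
Proof.
move=> Gsym Gval.
have csym : connect_sym (@link _ _ G) by apply: sym_connect_sym.
pose val (e : wire_end G) := label_value x y (vertex_label (end_vertex e)).
split=> [[c [clink cleg cin cout]] u v|eq_val].
  rewrite card_gt0 => /set0Pn[w]; rewrite inE => /andP[w_wire].
  case/existsP=> e /existsP[e' /and5P[_ ew e'w /eqP<- /eqP<-]].
  have cval f : val f = c (end_piece f).
    case: f => [l|[i|j]] /=; last 2 first.
    - by rewrite cin.
    - by rewrite cout.
    by rewrite cleg; apply: Gval.
  have cconn p q : connect (@link _ _ G) p q -> c p = c q.
    case/connectP=> s; elim: s p => [|r s IHs] p /=; first by move=> _ ->.
    by case/andP=> /clink -> /IHs h /h.
  rewrite -/(val e) -/(val e') !cval; apply: cconn.
  case/imsetP: w_wire ew e'w => p _ ->; rewrite !inE /= => pe pe'.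
  by apply: connect_trans pe'; rewrite csym.
(* The colour of a piece is the conjunction of the values at all ends of its wire; a closed loop,
   having no ends, gets [true]. *)
pose c p := [forall e, connect (@link _ _ G) p (end_piece e) ==> val e].
have cE e : c (end_piece e) = val e.
  apply/forallP/idP => [/(_ e)|ve e']; first by rewrite connect0.
  apply/implyP=> ee'; have [<- //|neq_ee'] := eqVneq e e'.
  (* The wire through [e] and [e'] is an edge between their vertices, so [eq_val] applies. *)
  rewrite /val -(@eq_val (end_vertex e) (end_vertex e')) // card_gt0.
  apply/set0Pn.
  exists [set q in [set: piece G] | connect (@link _ _ G) (end_piece e) q].
  rewrite inE; apply/andP; split.
    by apply/imsetP; exists (end_piece e).
  apply/existsP; exists e; apply/existsP; exists e'.
  by rewrite !inE neq_ee' connect0 ee' !eqxx.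
exists c; split.
- move=> p q lpq; apply: eq_forallb => e.
  by rewrite (same_connect csym (connect1 lpq)).
- by move=> l; rewrite (cE (inl l)); apply: Gval.
- by move=> i; rewrite (cE (inr (inl i))).
- by move=> j; rewrite (cE (inr (inr j))).
Qed.

Lemma link_sym n m (D : diag n m) : symmetric (@link _ _ (wiring_of D)).
Proof.
by elim: D => //= [? ? ? D2 IH2 D1 IH1|? ? ? ? D1 IH1 D2 IH2] [p|p] [q|q] //=.
Qed.

(** The type [wiring] would allow [LI] and [LO] on nodes; wirings of diagrams have only spider and
    [H] labels there. *)
Lemma node_label_value n m (D : diag n m) x y (v : node (wiring_of D)) :
  label_value x y (node_label v).
Proof. by elim: D v => //= [? ? ? ? IH2 ? IH1|? ? ? ? ? IH1 ? IH2] []. Qed.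

Lemma wiring_interp_comp n m p (G2 : wiring m p) (G1 : wiring n m) x y :
  wiring_interp (comp_wiring G2 G1) x y <->
  exists2 z, wiring_interp G1 x z & wiring_interp G2 z y.
Proof.
split=> [[c [clink cleg cin cout]]|[z [c1 [k1 l1 i1 o1]] [c2 [k2 l2 i2 o2]]]].
  (* The shared boundary reads its values off the output pieces of [G1]; the default [true] concerns
     only indices past the arity. *)
  exists (fun k => if insub k is Some j then c (inl (out_piece G1 j)) else true).
    exists (c \o inl)%FUN; split=> //= [q r|l|j].
    - exact: clink (inl q) (inl r).
    - exact: cleg (inl l).
    - by rewrite valK.
  exists (c \o inr)%FUN; split=> //= [q r|l|j].
  - exact: clink (inr q) (inr r).
  - exact: cleg (inr l).
  - rewrite valK; apply: (clink (inr _) (inl _)).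
    by apply/existsP; exists j; rewrite !eqxx.
exists (sum_case c1 c2); split=> //=.
- move=> [q|q] [r|r] //=; try by [apply: k1 | apply: k2].
    by case/existsP=> j /andP[/eqP<- /eqP<-]; rewrite o1 i2.
  by case/existsP=> j /andP[/eqP<- /eqP<-]; rewrite o1 i2.
- by case.
Qed.

Lemma wiring_interp_tens n m n' m' (G1 : wiring n m) (G2 : wiring n' m') x y :
  wiring_interp (tens_wiring G1 G2) x y <->
  wiring_interp G1 x y /\
  wiring_interp G2 (fun i => x (n + i)) (fun j => y (m + j)).
Proof.
split=> [[c [clink cleg cin cout]]|[[c1 [k1 l1 i1 o1]] [c2 [k2 l2 i2 o2]]]].
  split.
    exists (c \o inl)%FUN; split=> /= [q r|l|i|j].
    - exact: clink (inl q) (inl r).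
    - exact: cleg (inl l).
    - by have := cin (lshift n' i); rewrite /= (unsplitK (inl i)).
    - by have := cout (lshift m' j); rewrite /= (unsplitK (inl j)).
  exists (c \o inr)%FUN; split=> /= [q r|l|i|j].
  - exact: clink (inr q) (inr r).
  - exact: cleg (inr l).
  - by have := cin (rshift n i); rewrite /= (unsplitK (inr i)).
  - by have := cout (rshift m j); rewrite /= (unsplitK (inr j)).
exists (sum_case c1 c2); split=> /=.
- by move=> [q|q] [r|r] //=; [apply: k1 | apply: k2].
- by case.
- by move=> i; case: splitP => k -> /=.
- by move=> j; case: splitP => k -> /=.
Qed.

Lemma wiring_interp_box n m l x y :
  wiring_interp (box_wiring n m l) x y <->
  (forall i, i < n -> x i) /\ (forall j, j < m -> y j).
Proof.
split=> [[c [_ cleg cin cout]]|[hx hy]].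
  split=> [i lti|j ltj].
    by rewrite -(cin (Ordinal lti)); apply: (cleg (inl _)).
  by rewrite -(cout (Ordinal ltj)); apply: (cleg (inr _)).
by exists (fun=> true); split=> //= k; rewrite ?hx ?hy.
Qed.

Lemma wiring_interp_strand n m (P : finType) (i : 'I_n -> P) (o : 'I_m -> P) x y :
  wiring_interp (strand_wiring i o) x y <->
  exists c : P -> bool, (forall k, c (i k) = x k) /\ (forall k, c (o k) = y k).
Proof. by split=> [[c [_ _ ? ?]]|[c [? ?]]]; exists c; split. Qed.

Lemma interp_wiring n m (D : diag n m) x y :
  interp D x y <-> wiring_interp (wiring_of D) x y.
Proof.
elim: D x y => /=.
- move=> k x y; rewrite wiring_interp_strand; split=> [exy|[c [cx cy]] i lti].
    by exists (fun i : 'I_k => x i); split=> // i; apply: exy.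
  by rewrite -(cx (Ordinal lti)) -(cy (Ordinal lti)).
- by move=> k l a x y; rewrite wiring_interp_box.
- by move=> k l a x y; rewrite wiring_interp_box.
- move=> x y; rewrite wiring_interp_box; split=> [[hx hy]|[hx hy]].
    by split=> -[].
  by split; [apply: hx | apply: hy].
- move=> x y; rewrite wiring_interp_strand; split=> [[e0 e1]|[c [cx cy]]].
    (* A strand of the swap is indexed by its input, and [rev_ord] exchanges the outputs. *)
    by exists (fun i : 'I_2 => x i); split=> // -[[|[|//]] ? /=].
  rewrite -(cx ord0) -(cx ord_max) -(cy ord0) -(cy ord_max).
  by split; congr c; apply: val_inj.
- move=> x y; rewrite wiring_interp_strand; split=> [e|[c [cx _]]].
    by exists (fun=> x 0); split=> -[[|[|//]] ? /=].
  by rewrite -(cx ord0) -(cx ord_max).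
- move=> x y; rewrite wiring_interp_strand; split=> [e|[c [_ cy]]].
    by exists (fun=> y 0); split=> -[[|[|//]] ? /=].
  by rewrite -(cy ord0) -(cy ord_max).
- move=> k l p D2 IH2 D1 IH1 x y; rewrite wiring_interp_comp.
  by split=> -[z h1 h2]; exists z; apply/IH1 || apply/IH2.
- by move=> k l k' l' D1 IH1 D2 IH2 x y; rewrite wiring_interp_tens IH1 IH2.
Qed.

(** By [wiring_interpP] the relation depends only on the labels and on which pairs of vertices have
    an edge; [f] transports both. *)
Lemma interp_same_connectivity n m (D1 D2 : diag n m) :
  same_connectivity D1 D2 -> forall x y, interp D1 x y <-> interp D2 x y.
Proof.
move=> [[f [[g fK gK] flabel fedges]] _] x y; rewrite !interp_wiring.
rewrite !wiring_interpP; try by [apply: link_sym | apply: node_label_value].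
split=> h u v euv.
  by rewrite -(gK u) -(gK v) !flabel; apply: h; rewrite -fedges !gK.
by rewrite -!flabel; apply: h; rewrite fedges.
Qed.

(** * Soundness of the remaining rules and the conclusion *)

Lemma interp_rule r n m (D1 D2 : diag n m) :
  r <> S3'L -> rule r D1 D2 -> forall x y, interp D1 x y <-> interp D2 x y.
Proof.
have [fZ fX] := (forces_RZ, forces_RX).
move=> neq_r rD; case: rD neq_r => {r n m D1 D2} //.
- by move=> n m D1 D2 /interp_same_connectivity.
(* [interp_forces] turns both sides into the same condition, so only forcing claims remain. *)
all: move=> *; rewrite !interp_forces //.
- exact: forces_S1_lhs.
- exact: (forces_tens (fX 0 1 _) (fX 0 1 _)).
- exact: (forces_tens (forces_comp (fZ 1 0 _) (fX 0 1 _))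
                      (forces_comp (fZ 1 2 _) (fX 0 1 _))).
- exact: (forces_tens (forces_comp (fZ 1 0 _) (fX 0 1 _))
                      (forces_comp (fZ 1 2 _) (fX 2 1 _))).
- have fXX := forces_tens (fX 2 1 0%R) (fX 2 1 0%R).
  have fZZ := forces_tens (fZ 1 2 0%R) (fZ 1 2 0%R).
  apply: (@forces_tens 0 0 2 2); first exact: fZ.
  (* The layer with the swap forces nothing; the green spiders force the inputs and the red ones the
     outputs. *)
  split; first exact: forces_in_comp fZZ.1.
  by apply: forces_out_comp; apply: forces_out_comp fXX.2.
(* The layer with [Id 1] is not forcing, but the chain starts and ends with a green spider. *)
- split; first exact: forces_in_comp (fZ _ _ _).1.
  by do 3!apply: forces_out_comp; apply: (fZ _ _ _).2.
- exact: forces_Had.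
- by apply: forces_comp; [apply: forces_comp|]; try apply: forces_Hpow.
Qed.

Lemma interp_derivable n m (D1 D2 : diag n m) :
  derivable (ZXsimp_without S3'L) D1 D2 ->
  forall x y, interp D1 x y <-> interp D2 x y.
Proof.
elim=> {n m D1 D2}.
- by move=> n m D1 D2 [r neq_r /interp_rule]; apply.
- exact: interp_strict_monoidal.
- by [].
- by move=> n m D1 D2 _ IH x y; rewrite IH.
- by move=> n m D1 D2 D3 _ IH12 _ IH23 x y; rewrite IH12.
- move=> n m p D2 D2' D1 D1' _ IH2 _ IH1 x y /=.
  by split=> -[z h1 h2]; exists z; apply/IH1 || apply/IH2.
- by move=> n m n' m' D1 D1' D2 D2' _ IH1 _ IH2 x y /=; rewrite IH1 IH2.
Qed.

Theorem lemma3p2 : ~ derivable (ZXsimp_without S3'L) Cap (RZ 0 2 0%R).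
Proof.
(* Here [erefl] proves the condition of the cap, [false = false]. *)
move=> /interp_derivable /(_ (fun=> false) (fun=> false)) [/(_ erefl) /= h _].
by have := h.2 0 isT.
Qed.
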